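(* Let $\mathcal U_{3,\mathbb R}$ be the set of all polynomials $p(z)=z+a_2z^2+a_3z^3$ with $a_2,a_3\in\mathbb R$ that are univalent in $\mathbb D$. Let $$p_3(z)=z+\frac{2}{\sqrt5}z^2+\frac12\left(1-\frac1{\sqrt5}\right)z^3,\qquad p_3^*(z)=-p_3(-z)=z-\frac{2}{\sqrt5}z^2+\frac12\left(1-\frac1{\sqrt5}\right)z^3.$$ Then $p_3$ and $p_3^*$ are extremal for the class $\mathcal U_{3,\mathbb R}$, and they are the only extremal polynomials for this class. That is, $p_3,p_3^*\in\mathcal U_{3,\mathbb R}$, and for $F\in\mathcal U_{3,\mathbb R}$ one has $m(F)=\inf\{m(p):p\in\mathcal U_{3,\mathbb R}\}$ if and only if $F=p_3$ or $F=p_3^*$.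
   Context: $\mathbb D=\{z\in\mathbb C:|z|<1\}$ and $\mathbb T=\{z\in\mathbb C:|z|=1\}$. A polynomial is univalent in $\mathbb D$ if it is injective on $\mathbb D$. The coefficients $a_2,a_3$ are allowed to vanish, so $\mathcal U_{3,\mathbb R}$ contains polynomials of degree at most $3$. For a polynomial $p$, $m(p):=\min\{|p(\zeta)|:\zeta\in\mathbb T\}$. If $X$ is a class of polynomials and $F\in X$, then $F$ is called extremal for $X$ if $\inf\{m(p):p\in X\}=m(F)$. *)

(* Defs.v *)
From HB Require Import structures.
From mathcomp Require Import all_boot all_order all_algebra.
From mathcomp Require Import all_classical all_reals all_analysis.
From mathcomp Require Import complex ring lra.

Set Implicit Arguments.
Unset Strict Implicit.
Unset Printing Implicit Defensive.

Import Order.TTheory GRing.Theory Num.Theory numFieldNormedType.Exports.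

Local Open Scope classical_set_scope.
Local Open Scope ring_scope.
Local Open Scope complex_scope.

Section Defs.
Variable R : realType.

Definition unit_disc : set R[i] := [set z | `|z| < 1].

Definition unit_circle : set R[i] := [set z | `|z| = 1].

Definition univalent (p : {poly R[i]}) : Prop :=
  set_inj unit_disc (horner p).

(* [`|z|] lives in [R[i]], while [ComplexField.Normc.normc z : R]. The infimum
   is attained, see [min_modulus_attained]. *)
Definition min_modulus (p : {poly R[i]}) : R :=
  inf [set ComplexField.Normc.normc p.[z] | z in unit_circle].

Definition extremal (X : set {poly R[i]}) (F : {poly R[i]}) : Prop :=
  X F /\ inf [set min_modulus p | p in X] = min_modulus F.

Definition cubic (a2 a3 : R) : {poly R[i]} :=
  'X + a2%:C *: 'X^2 + a3%:C *: 'X^3.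

Definition U3R : set {poly R[i]} :=
  [set p | (exists a2 a3 : R, p = cubic a2 a3) /\ univalent p].

Definition p3 : {poly R[i]} :=
  cubic (2 / Num.sqrt 5) (1 / 2 * (1 - 1 / Num.sqrt 5)).

Definition p3star : {poly R[i]} := - (p3 \Po (- 'X)).

Lemma p3starE :
  p3star = cubic (- (2 / Num.sqrt 5)) (1 / 2 * (1 - 1 / Num.sqrt 5)).
Proof.
rewrite /p3star /p3 /cubic !comp_polyD !comp_polyZ !rmorphXn /= !comp_polyX.
by rewrite rmorphN /=; move: (_%:C) (_%:C) => a b; rewrite -!mul_polyC; ring.
Qed.

Let cx (u : R * R) : R[i] := u.1 +i* u.2.

Let horner_continuous (p : {poly R[i]}) :
  continuous (fun u => complex.Re p.[cx u]) /\
  continuous (fun u => complex.Im p.[cx u]).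
Proof.
elim/poly_ind: p => [|p [a b] [IHr IHi]].
  by split; under eq_fun do rewrite horner0; exact: cst_continuous.
have E u : p.[cx u] * cx u + (a +i* b) =
    (complex.Re p.[cx u] * u.1 - complex.Im p.[cx u] * u.2 + a) +i*
    (complex.Re p.[cx u] * u.2 + complex.Im p.[cx u] * u.1 + b).
  by case: (p.[cx u]).
split; under eq_fun do rewrite hornerMXaddC E /=; move=> u.
  apply: cvgD; last exact: cvg_cst.
  by apply: cvgB; apply: cvgM;
    [exact: IHr|exact: cvg_fst|exact: IHi|exact: cvg_snd].
apply: cvgD; last exact: cvg_cst.
by apply: cvgD; apply: cvgM;
  [exact: IHr|exact: cvg_snd|exact: IHi|exact: cvg_fst].
Qed.

Let circleE (x y : R) : unit_circle (x +i* y) <-> x ^+ 2 + y ^+ 2 = 1.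
Proof.
rewrite /unit_circle /= normc_def /=; split=> [[] h|->]; last by rewrite sqrtr1.
by rewrite -[LHS]sqr_sqrtr ?addr_ge0 ?sqr_ge0// h expr1n.
Qed.

Lemma min_modulus_attained (p : {poly R[i]}) :
  exists2 z, unit_circle z &
    min_modulus p = ComplexField.Normc.normc p.[z] /\
    (forall w, unit_circle w ->
       ComplexField.Normc.normc p.[z] <= ComplexField.Normc.normc p.[w]).
Proof.
have [contRe contIm] := horner_continuous p.
pose f u := ComplexField.Normc.normc p.[cx u].
have cf : continuous f.
  have -> : f = Num.sqrt \o (fun u => complex.Re p.[cx u] ^+ 2 +
                                     complex.Im p.[cx u] ^+ 2).
    by apply/funext => u; rewrite /f /=; case: (p.[cx u]).
  move=> u; apply: continuous_comp; last exact: sqrt_continuous.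
  by apply: cvgD; apply: cvgM; (exact: contRe || exact: contIm).
pose A := [set u : R * R | u.1 ^+ 2 + u.2 ^+ 2 = 1].
have cA : compact A.
  apply: (@subclosed_compact _ A (`[-1, 1]%classic `*` `[-1, 1]%classic)).
  - have -> : A = (fun u : R * R => u.1 ^+ 2 + u.2 ^+ 2) @^-1` [set x | x = 1].
      by [].
    apply: preimage_closed; last exact: closed_eq.
    move=> u _; apply: cvgD; apply: cvgM; (exact: cvg_fst || exact: cvg_snd).
  - by apply: compact_setX; exact: segment_compact.
  - move=> [x y]; rewrite /A /= => e.
    by rewrite !in_itv /=; split; apply/andP; split; nra.
have A0 : A !=set0 by exists (1, 0); rewrite /A /= expr1n expr0n addr0.
have [[x y] cAx cmin] := compact_EVT_min A0 cA (continuous_subspaceT cf).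
have zC : unit_circle (x +i* y) by apply/circleE; move: cAx; rewrite inE.
have zmin w : unit_circle w ->
    ComplexField.Normc.normc p.[x +i* y] <= ComplexField.Normc.normc p.[w].
  by case: w => s t /circleE st; apply: (cmin (s, t)); rewrite inE.
exists (x +i* y) => //; split=> //; apply/eqP; rewrite eq_le; apply/andP; split.
  apply: ge_inf; last by exists (x +i* y).
  by exists (ComplexField.Normc.normc p.[x +i* y]) => _ [w wC <-]; exact: zmin.
apply: lb_le_inf; last by move=> _ [w wC <-]; exact: zmin.
by exists (ComplexField.Normc.normc p.[x +i* y]), (x +i* y).
Qed.

End Defs.

Arguments U3R R : clear implicits.

(* Main.v *)
Require Import Defs.
From mathcomp Require Import all_boot all_order all_algebra.
From mathcomp Require Import all_classical all_reals all_analysis.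
From mathcomp Require Import complex.
From mathcomp Require Import ring lra.

(* Put p = z + a z^2 + b z^3.
   Necessary conditions. Univalence forbids p(z) = p(w) for conjugate pairs
   z, w, so 1 - b + 2 a x + 4 b x^2 >= 0 on [-1, 1]; the endpoints give
   2|a| <= 1 + 3b, and the vertex gives a^2 <= 4 b (1 - b) when b >= 1/5. Pairs
   z, w with z - w real give b <= 1/3. Under these three conditions |p|^2, which
   on the circle is a quadratic in the real part of z, is at least
   ((3 - sqrt 5) / 2)^2; equality forces z = 1 or z = -1 and determines |a|, b.
   Univalence of p_3. Write b = 1 / (1 + k^2) and a = 2 k b; here k is plus or
   minus the golden ratio. Then (p(z) - p(w)) / (z - w) vanishes iff
   (z + w + k)^2 = z w - 1. With s = z + w + k this makes both z + w = s - k and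
   z w = 1 + s^2 functions of s, and no s in the plane yields a point of the
   symmetrized bidisc, i.e. |sigma - conj(sigma) pi| < 1 - |pi|^2 fails for
   sigma = s - k, pi = 1 + s^2. *)

Set Implicit Arguments.
Unset Strict Implicit.
Unset Printing Implicit Defensive.

Import Order.TTheory GRing.Theory Num.Theory.

Local Open Scope classical_set_scope.
Local Open Scope ring_scope.
Local Open Scope complex_scope.

(** * Polynomial inequalities, mostly about the symmetrized bidisc *)

Section RealInequalities.
Variable R : realFieldType.
Implicit Types a b c d k r u v x y rho X Y : R.

Lemma quadratic_ge0_at1 a b c :
  (forall x, -1 < x < 1 -> 0 <= a + b * x + c * x ^+ 2) -> 0 <= a + b + c.
Proof.
move=> q0; rewrite leNgt; apply/negP => h.
pose m1 : R := `|b + 2 * c|; pose m2 : R := `|c|.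
have bm : - (b + 2 * c) <= m1 by rewrite /m1 -normrN ler_norm.
have cm : c <= m2 by exact: ler_norm.
have m10 : 0 <= m1 by exact: normr_ge0.
have m20 : 0 <= m2 by exact: normr_ge0.
have d0 : 0 < 1 - (a + b + c) + (m1 + m2) by lra.
(* With [q] the quadratic, [q(1 - e) <= q(1) + e * (m1 + m2) = - e * (1 - q(1)) < 0]. *)
pose e : R := - (a + b + c) / (1 - (a + b + c) + (m1 + m2)).
have eE : e * (1 - (a + b + c) + (m1 + m2)) = - (a + b + c).
  by rewrite /e mulfVK// gt_eqF.
have e0 : 0 < e by rewrite divr_gt0//; lra.
have e1 : e < 1 by rewrite /e ltr_pdivrMr//; lra.
have qe : 0 <= a + b * (1 - e) + c * (1 - e) ^+ 2 by apply: q0; lra.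
have H1 : 0 <= e * (m1 + (b + 2 * c)) by rewrite mulr_ge0; lra.
have H2 : 0 <= e ^+ 2 * (m2 - c) by rewrite mulr_ge0 ?sqr_ge0//; lra.
have H3 : 0 <= e * (1 - e) * m2.
  by apply: mulr_ge0 => //; apply: mulr_ge0; lra.
have H4 : 0 <= e * - (a + b + c) by rewrite mulr_ge0//; lra.
lra.
Qed.

(** For [z = x + iy] and [w = u + iv] the last factor is [|1 - conj(z) w|^2], so the difference is
    positive when both points lie in the disc. *)
Lemma symmetrized_bidisc x y u v (sr := x + u) (si := y + v)
    (pr := x * u - y * v) (pi := x * v + y * u) :
  (1 - pr ^+ 2 - pi ^+ 2) ^+ 2 -
    ((sr - (sr * pr + si * pi)) ^+ 2 + (si - (sr * pi - si * pr)) ^+ 2) =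
  (1 - x ^+ 2 - y ^+ 2) * (1 - u ^+ 2 - v ^+ 2) *
    ((1 - (x * u + y * v)) ^+ 2 + (x * v - y * u) ^+ 2).
Proof. by rewrite /sr /si /pr /pi; ring. Qed.

(* The left-hand side is affine in [rho], hence checked at both endpoints. *)
Lemma affine_in_rho_ge0 d rho : 0 <= d -> 2 + d <= 3 * rho -> rho + d <= 2 ->
  0 <= 13 / 25 * rho - (2 - rho - d) * (2 + d) ^+ 2 / 16
       + d ^+ 2 / 4 * (2 + d - 3 * rho).
Proof.
move=> d0 dr rd.
have [d1|d1] := leP 1 d.
  have -> : d = 1 by lra.
  have -> : rho = 1 by lra.
  lra.
(* The factor is the length of the interval [[(2 + d) / 3, 2 - d]] for [rho]; [H1] and [H2] are the
   endpoint values, [H3] and [H4] weight them. *)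
rewrite -(@pmulr_rge0 _ (4 / 3 * (1 - d))); last lra.
have H1 : 0 <= (2 + d) * (13 / 75 - (1 - d) * (2 + d) / 12).
  apply: mulr_ge0; first lra.
  have := sqr_ge0 d; lra.
have H2 : 0 <= 13 / 25 * (2 - d) - d ^+ 2 * (1 - d).
  have : 0 <= (1 - d) * d * (1 - d) by rewrite !mulr_ge0//; lra.
  have : 0 <= d * (1 - d) by rewrite mulr_ge0//; lra.
  have := sqr_ge0 (1 - 2 * d).
  lra.
have H3 : 0 <= (2 - d - rho) * ((2 + d) * (13 / 75 - (1 - d) * (2 + d) / 12)).
  by apply: mulr_ge0 => //; lra.
have H4 : 0 <= (rho - (2 + d) / 3) * (13 / 25 * (2 - d) - d ^+ 2 * (1 - d)).
  by apply: mulr_ge0 => //; lra.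
lra.
Qed.

(** The correction is negative only if [3 * rho > 2 + d]. Then a fifth of [k ^+ 2 >= 13 / 5] yields
    the 13/25 of [affine_in_rho_ge0]. *)
Lemma square_plus_correction_ge0 d rho k X :
  0 <= d -> rho + d <= 2 -> 0 < rho ->
  13 / 5 <= k ^+ 2 -> 4 * X ^+ 2 = rho * (2 - rho - d) ->
  0 <= (k * rho + X * (2 + d)) ^+ 2
       + rho * (d ^+ 2 / 4 * (2 + d - 3 * rho)).
Proof.
move=> d0 rd r0 k2 XE.
have [dr|/ltW dr] := leP (3 * rho) (2 + d).
  rewrite addr_ge0 ?sqr_ge0// mulr_ge0 ?(ltW r0)// mulr_ge0 ?subr_ge0//.
  by rewrite divr_ge0 ?sqr_ge0.
have H := mulr_ge0 (ltW r0) (affine_in_rho_ge0 d0 dr rd).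
(* [(p + q)^2 >= p^2 / 5 - q^2 / 4], with [p = k rho] and [q = X (2 + d)] *)
have H1 : 0 <= (4 * (k * rho) + 5 * (X * (2 + d))) ^+ 2 by apply: sqr_ge0.
have H2 : 0 <= rho ^+ 2 * (k ^+ 2 - 13 / 5).
  by rewrite mulr_ge0 ?sqr_ge0// subr_ge0.
have H3 : (X * (2 + d)) ^+ 2 = rho * (2 - rho - d) * (2 + d) ^+ 2 / 4.
  by rewrite -XE; field.
lra.
Qed.

(* With [s = X + iY], [sigma = s - k] and [pi = 1 + s^2], [D] is
   [1 - |pi|^2] and the right-hand side is [|sigma - conj(sigma) pi|^2]. *)
Lemma outside_symmetrized_bidisc k X Y (rho := X ^+ 2 + Y ^+ 2)
    (D := 2 * Y ^+ 2 - 2 * X ^+ 2 - rho ^+ 2) :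
  13 / 5 <= k ^+ 2 -> 0 < D ->
  D ^+ 2 <= (k * (X ^+ 2 - Y ^+ 2) - rho * X) ^+ 2 +
            (Y * (2 + 2 * k * X - rho)) ^+ 2.
Proof.
move=> k2 D0.
have r0 : 0 < rho.
  rewrite lt_neqAle addr_ge0 ?sqr_ge0// andbT eq_sym; apply/eqP => r0.
  have : X ^+ 2 >= 0 by apply: sqr_ge0.
  by move: D0; rewrite /D r0; move: r0; rewrite /rho; nra.
pose d := D / rho.
have dE : rho * d = D by rewrite mulrC mulfVK// gt_eqF.
have d0 : 0 <= d by rewrite divr_ge0// ltW.
have X2 : 4 * X ^+ 2 = rho * (2 - rho - d).
  by rewrite !mulrBr dE /D /rho; ring.
have dg : rho + d <= 2.
  have : 0 <= rho * (2 - rho - d) by rewrite -X2 mulr_ge0 ?sqr_ge0.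
  by rewrite pmulr_rge0//; lra.
have H := square_plus_correction_ge0 d0 dg r0 k2 X2.
have Y2 : Y ^+ 2 = rho - X ^+ 2 by rewrite /rho; ring.
have {}X2 : X ^+ 2 = rho * (2 - rho - d) / 4 by rewrite -X2; field.
rewrite -subr_ge0; apply: etrans H; congr (0 <= _).
rewrite -dE [(Y * _) ^+ 2]exprMn Y2.
apply/eqP; rewrite -subr_eq0; apply/eqP.
transitivity ((X ^+ 2 - rho * (2 - rho - d) / 4) *
    (rho ^+ 2 - (2 - rho) ^+ 2 - (2 + d) ^+ 2 - 8 * k * X)).
  by field.
by rewrite X2 subrr mul0r.
Qed.

(* The two equations are the real and imaginary parts of
   [(z + w + k)^2 = z w - 1] for [z = x + iy], [w = u + iv]. *)
Lemma difference_quotient_nonvanishing k x y u v : 13 / 5 <= k ^+ 2 ->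
  x ^+ 2 + y ^+ 2 < 1 -> u ^+ 2 + v ^+ 2 < 1 ->
  (x + u + k) ^+ 2 - (y + v) ^+ 2 = (x * u - y * v) - 1 ->
  2 * (x + u + k) * (y + v) = x * v + y * u -> False.
Proof.
move=> k2 z1 w1 er ei.
have P : (x * u - y * v) ^+ 2 + (x * v + y * u) ^+ 2 =
  (x ^+ 2 + y ^+ 2) * (u ^+ 2 + v ^+ 2) by ring.
have z0 : 0 <= x ^+ 2 + y ^+ 2 by rewrite addr_ge0 ?sqr_ge0.
have w0 : 0 <= u ^+ 2 + v ^+ 2 by rewrite addr_ge0 ?sqr_ge0.
have CS : 0 < 1 - (x * u + y * v).
  have : 0 <= (x - u) ^+ 2 + (y - v) ^+ 2 by rewrite addr_ge0 ?sqr_ge0.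
  lra.
have : 0 < (1 - x ^+ 2 - y ^+ 2) * (1 - u ^+ 2 - v ^+ 2) *
    ((1 - (x * u + y * v)) ^+ 2 + (x * v - y * u) ^+ 2).
  by rewrite !mulr_gt0//; [lra|lra|rewrite ltr_wpDr ?sqr_ge0// exprn_gt0].
rewrite -symmetrized_bidisc.
have : 0 < 1 - ((x * u - y * v) ^+ 2 + (x * v + y * u) ^+ 2).
  by rewrite P; nra.
set X := x + u + k in er ei *; set Y := y + v in er ei *.
have -> : x + u = X - k by rewrite /X; ring.
have -> : x * u - y * v = 1 + X ^+ 2 - Y ^+ 2 by lra.
rewrite -ei => D0 E0.
have := @outside_symmetrized_bidisc k X Y k2.
have DE : 2 * Y ^+ 2 - 2 * X ^+ 2 - (X ^+ 2 + Y ^+ 2) ^+ 2 =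
  1 - ((1 + X ^+ 2 - Y ^+ 2) ^+ 2 + (2 * X * Y) ^+ 2) by ring.
rewrite DE => /(_ D0).
apply/negP; rewrite -ltNge -subr_gt0; apply: lt_le_trans E0 _.
by rewrite le_eqVlt; apply/orP; left; apply/eqP; ring.
Qed.

End RealInequalities.

(** * Lower bound for the modulus on the unit circle *)

Section RealClosed.
Variable R : rcfType.
Implicit Types a b x : R.

Lemma quadratic_root a b : a + b + 1 < 0 ->
  exists2 t, 0 < t < 1 & a * t ^+ 2 + b * t + 1 = 0.
Proof.
move=> ab1.
pose p : {poly R} := - (a *: 'X^2 + b *: 'X + 1).
have pE t : p.[t] = - (a * t ^+ 2 + b * t + 1) by rewrite /p !hornerE.
have [||t /andP[t0 t1]] := @poly_ivt _ p 0 1; first exact: ler01.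
  by rewrite !pE; apply/andP; split; lra.
rewrite /root pE oppr_eq0 => /eqP pt0; exists t => //.
rewrite !lt_neqAle t0 t1 !andbT; apply/andP; split; apply/eqP => t01.
  by move: pt0; rewrite -t01; lra.
by move: pt0; rewrite t01; lra.
Qed.

(* [|z + a z^2 + b z^3|^2] on the unit circle, where [x] is the real part
   of [z]. *)
Definition cubic_sqmod a b x : R :=
  1 + a ^+ 2 + b ^+ 2 - 2 * b + 2 * a * (1 + b) * x + 4 * b * x ^+ 2.

Lemma sqrt5_sqr : Num.sqrt (5 : R) ^+ 2 = 5.
Proof. by rewrite sqr_sqrtr// ler0n. Qed.

(** The lower bound is tight: it gives [(3 - sqrt 5) / 2 < 34 / 89], and [cubic_interior_bound] has
    little slack. *)
Lemma sqrt5_bounds : 199 / 89 < Num.sqrt (5 : R) < 9 / 4.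
Proof.
have r0 : 0 <= Num.sqrt (5 : R) by exact: sqrtr_ge0.
have := sqrt5_sqr; move: (Num.sqrt _) r0 => r r0 r2.
apply/andP; split; rewrite ltNge; apply/negP => h.
  have : 0 <= (199 / 89 - r) * (199 / 89 + r) by rewrite mulr_ge0//; lra.
  lra.
have : 0 <= (r - 9 / 4) * (9 / 4 + r) by rewrite mulr_ge0//; lra.
lra.
Qed.

Lemma sqrt5V : (Num.sqrt (5 : R))^-1 = Num.sqrt 5 / 5.
Proof.
have /andP[r_lo _] := sqrt5_bounds.
by rewrite -[X in _ / X]sqrt5_sqr; field; apply/eqP; lra.
Qed.

(** For [b < 1/5] the first hypothesis gives [1 + b - a >= (1 - b) / 2 > 2/5]. Otherwise, the line
    [1 + b - a = (3 - r) / 2] is tangent to the ellipse [a^2 = 4 b (1 - b)] at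
    [b = (5 - r) / 10]. *)
Lemma cubic_endpoint_bound a b (r := Num.sqrt 5 : R) :
  2 * a <= 1 + 3 * b -> 3 * b <= 1 ->
  (1 / 5 <= b -> a ^+ 2 <= 4 * b * (1 - b)) ->
  (3 - r) / 2 <= 1 + b - a /\
  ((3 - r) / 2 = 1 + b - a -> a = 2 / r /\ b = 1 / 2 * (1 - 1 / r)).
Proof.
move=> h1 h2 h3.
have r2 : r ^+ 2 = 5 := sqrt5_sqr.
have /andP[r_lo r_hi] : 199 / 89 < r < 9 / 4 := sqrt5_bounds.
have rV : r^-1 = r / 5 := sqrt5V.
clearbody r.
have [b5|b5] := ltP b (1 / 5); first by split=> [|?]; [lra|exfalso; lra].
have {}h3 := h3 b5.
have E : (b + (r - 1) / 2) ^+ 2 - 4 * b * (1 - b) =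
    5 * (b - (5 - r) / 10) ^+ 2.
  transitivity (5 * (b - (5 - r) / 10) ^+ 2 + (r ^+ 2 - 5) / 5); first by field.
  by rewrite r2 subrr mul0r addr0.
have sq0 := sqr_ge0 (b - (5 - r) / 10).
split.
  have : a ^+ 2 <= (b + (r - 1) / 2) ^+ 2 by lra.
  rewrite -[a ^+ 2]real_normK ?num_real// ler_sqr ?nnegrE//; last lra.
  have := ler_norm a; lra.
move=> eq.
have aE : a = b + (r - 1) / 2 by lra.
have : (b - (5 - r) / 10) ^+ 2 = 0 by move: h3; rewrite aE; lra.
move=> /eqP; rewrite sqrf_eq0 subr_eq0 => /eqP bE.
by rewrite rV; split; lra.
Qed.

(* When the vertex of [cubic_sqmod a b] is inside ]-1, 1[, completing the
   square gives [(1 - b)^2 (1 - a^2 / 4b)], which is at least [b (1 - b)^2] and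
   at least [(1 - b)^4 / (1 + b)^2]; 5/17 is where one bound takes over from the
   other. *)
Lemma cubic_interior_bound a b x (r := Num.sqrt 5 : R) :
  0 <= a -> 0 < b -> a * (1 + b) < 4 * b -> 3 * b <= 1 ->
  (1 / 5 <= b -> a ^+ 2 <= 4 * b * (1 - b)) ->
  ((3 - r) / 2) ^+ 2 < cubic_sqmod a b x.
Proof.
move=> a0 b0 h1 h2 h3.
have r2 : r ^+ 2 = 5 := sqrt5_sqr.
have /andP[r_lo r_hi] : 199 / 89 < r < 9 / 4 := sqrt5_bounds.
clearbody r.
have q1 : (1 - b) ^+ 2 * (4 * b - a ^+ 2) <= 4 * b * cubic_sqmod a b x.
  rewrite -subr_ge0 (_ : _ - _ = (4 * b * x + a * (1 + b)) ^+ 2) ?sqr_ge0//.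
  by rewrite /cubic_sqmod; ring.
rewrite -(@ltr_pM2l _ (4 * b)); last lra.
have [b5|b5] := leP (5 / 17) b.
  have {}h3 : a ^+ 2 <= 4 * b * (1 - b) by apply: h3; lra.
  have : 0 <= (1 - b) ^+ 2 * (4 * b * (1 - b) - a ^+ 2).
    by rewrite mulr_ge0 ?sqr_ge0// subr_ge0.
  have : 0 < b * ((1 - b) ^+ 2 * b - ((3 - r) / 2) ^+ 2); last lra.
  rewrite mulr_gt0//.
  have : 0 <= (b - 5 / 17) * (1 / 3 - b) by rewrite mulr_ge0; lra.
  have : 0 <= (b - 5 / 17) * (1 / 3 - b) * (1 - b).
    by rewrite !mulr_ge0; lra.
  lra.
have a2 : (a * (1 + b)) ^+ 2 < (4 * b) ^+ 2.
  by rewrite ltr_sqr ?nnegrE ?mulr_ge0//; lra.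
rewrite -(@ltr_pM2l _ ((1 + b) ^+ 2)); last by rewrite exprn_gt0; lra.
have : 0 <= (1 + b) ^+ 2 *
    (4 * b * cubic_sqmod a b x - (1 - b) ^+ 2 * (4 * b - a ^+ 2)).
  by rewrite mulr_ge0 ?sqr_ge0// subr_ge0.
have : 0 <= (1 - b) ^+ 2 * ((4 * b) ^+ 2 - (a * (1 + b)) ^+ 2).
  by rewrite mulr_ge0 ?sqr_ge0// subr_ge0 ltW.
have : 0 < 4 * b * (((1 - b) ^+ 2) ^+ 2 - ((3 - r) / 2 * (1 + b)) ^+ 2).
  rewrite mulr_gt0//; first lra.
  rewrite subr_gt0 ltr_sqr ?nnegrE ?sqr_ge0 ?mulr_ge0//; try lra.
  have : 0 < (1 + b) * (r - 199 / 89) by rewrite mulr_gt0; lra.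
  have : 0 <= (5 / 17 - b) ^+ 2 by apply: sqr_ge0.
  lra.
lra.
Qed.

(** Either the vertex is interior and the bound is strict, or the minimum over [-1, 1] is at -1,
    with value [(1 + b - a)^2]. *)
Lemma cubic_sqmod_bound a b x (r := Num.sqrt 5 : R) :
  0 <= a -> 2 * a <= 1 + 3 * b -> 3 * b <= 1 ->
  (1 / 5 <= b -> a ^+ 2 <= 4 * b * (1 - b)) -> -1 <= x <= 1 ->
  ((3 - r) / 2) ^+ 2 <= cubic_sqmod a b x /\
  (cubic_sqmod a b x = ((3 - r) / 2) ^+ 2 ->
   a = 2 / r /\ b = 1 / 2 * (1 - 1 / r)).
Proof.
move=> a0 h1 h2 h3 /andP[x1 x2].
have /andP[r_lo r_hi] : 199 / 89 < r < 9 / 4 := sqrt5_bounds.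
have [e1 e2] := cubic_endpoint_bound h1 h2 h3; rewrite -/r in e1 e2.
have [h4|h4] := ltP (a * (1 + b)) (4 * b).
  have ab0 : 0 <= a * (1 + b) by rewrite mulr_ge0//; lra.
  have b0 : 0 < b by lra.
  have := cubic_interior_bound x a0 b0 h4 h2 h3; rewrite -/r => lt_q.
  by split; [exact: ltW|move=> q_eq; rewrite q_eq ltxx in lt_q].
have q1 : (1 + b - a) ^+ 2 <= cubic_sqmod a b x.
  rewrite -subr_ge0 (_ : _ - _ =
      (1 + x) * (2 * (a * (1 + b)) + 4 * b * (x - 1))); last first.
    by rewrite /cubic_sqmod; ring.
  rewrite mulr_ge0//; first lra.
  have [b0|b0] := leP 0 b.
    have : 0 <= b * (1 + x) by rewrite mulr_ge0//; lra.
    lra.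
  have : 0 <= (- b) * (1 - x) by rewrite mulr_ge0//; lra.
  have : 0 <= a * (1 + b) by rewrite mulr_ge0//; lra.
  lra.
have e0 : 0 <= (3 - r) / 2 by lra.
split.
  by apply: le_trans q1; rewrite ler_sqr ?nnegrE//; exact: le_trans e1.
move=> q_eq; apply: e2; apply/eqP; rewrite eq_le e1 /=.
by rewrite -ler_sqr ?nnegrE -?q_eq//; exact: le_trans e1.
Qed.

End RealClosed.

(** * Real coordinates and a sufficient condition for univalence *)

Section Univalence.
Variable R : realType.
Implicit Types a b d k s x y u v : R.

Lemma unit_discE x y : unit_disc (x +i* y) <-> x ^+ 2 + y ^+ 2 < 1.
Proof.
by rewrite /unit_disc /= normc_def /= ltcR -{1}(@sqrtr1 R) ltr_sqrt ?ltr01.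
Qed.

Lemma unit_circleE x y : unit_circle (x +i* y) <-> x ^+ 2 + y ^+ 2 = 1.
Proof.
rewrite /unit_circle /= normc_def /=; split=> [[] h|->]; last by rewrite sqrtr1.
by rewrite -[LHS]sqr_sqrtr ?addr_ge0 ?sqr_ge0// h expr1n.
Qed.

Definition cubic_re a b x y : R :=
  x + a * (x ^+ 2 - y ^+ 2) + b * (x ^+ 3 - 3 * x * y ^+ 2).

Definition cubic_im a b x y : R :=
  y + 2 * a * x * y + b * (3 * x ^+ 2 * y - y ^+ 3).

Lemma horner_cubic a b x y :
  (cubic a b).[x +i* y] = cubic_re a b x y +i* cubic_im a b x y.
Proof.
rewrite /cubic !hornerE /=.
apply/eqP; rewrite eq_complex /cubic_re /cubic_im; simpc.
by apply/andP; split; apply/eqP => /=; ring.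
Qed.

Lemma univalent_cubicP a b : univalent (cubic a b) <->
  forall x y u v, x ^+ 2 + y ^+ 2 < 1 -> u ^+ 2 + v ^+ 2 < 1 ->
    cubic_re a b x y = cubic_re a b u v ->
    cubic_im a b x y = cubic_im a b u v -> x = u /\ y = v.
Proof.
split=> [uni x y u v /unit_discE z1 /unit_discE w1 er ei|inj [x y] [u v]].
  have := uni (x +i* y) (u +i* v).
  by rewrite !inE !horner_cubic er ei => /(_ z1 w1 erefl) [].
rewrite !inE => /unit_discE z1 /unit_discE w1.
by rewrite !horner_cubic => -[er ei]; have [-> ->] := inj _ _ _ _ z1 w1 er ei.
Qed.

Lemma cubic_univalent k a b : 13 / 5 <= k ^+ 2 ->
  b * (1 + k ^+ 2) = 1 -> a = 2 * k * b -> univalent (cubic a b).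
Proof.
move=> k2 bk aE; apply/univalent_cubicP => x y u v z1 w1 er ei.
(* [qr + i qi] is the difference quotient divided by [b]. *)
pose qr := (x + u + k) ^+ 2 - (y + v) ^+ 2 - (x * u - y * v) + 1.
pose qi := 2 * (x + u + k) * (y + v) - (x * v + y * u).
have b0 : b != 0.
  by apply: contra_eq_neq bk => ->; rewrite mul0r eq_sym oner_eq0.
have Er : (x - u) * qr - (y - v) * qi = 0.
  apply: (mulfI b0); rewrite mulr0 -(subrr (cubic_re a b u v)) -{1}er.
  transitivity (cubic_re a b x y - cubic_re a b u v +
                (b * (1 + k ^+ 2) - 1) * (x - u)).
    by rewrite /cubic_re /qr /qi aE; ring.
  by rewrite bk subrr mul0r addr0.
have Ei : (x - u) * qi + (y - v) * qr = 0.
  apply: (mulfI b0); rewrite mulr0 -(subrr (cubic_im a b u v)) -{1}ei.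
  transitivity (cubic_im a b x y - cubic_im a b u v +
                (b * (1 + k ^+ 2) - 1) * (y - v)).
    by rewrite /cubic_im /qr /qi aE; ring.
  by rewrite bk subrr mul0r addr0.
have [n0|n0] := eqVneq ((x - u) ^+ 2 + (y - v) ^+ 2) 0.
  move/eqP: n0; rewrite paddr_eq0 ?sqr_ge0// !sqrf_eq0 !subr_eq0.
  by move=> /andP[/eqP -> /eqP ->].
have qr0 : qr = 0.
  apply: (mulfI n0); rewrite mulr0.
  have -> : ((x - u) ^+ 2 + (y - v) ^+ 2) * qr =
    (x - u) * ((x - u) * qr - (y - v) * qi) +
    (y - v) * ((x - u) * qi + (y - v) * qr) by ring.
  by rewrite Er Ei !mulr0 addr0.
have qi0 : qi = 0.
  apply: (mulfI n0); rewrite mulr0.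
  have -> : ((x - u) ^+ 2 + (y - v) ^+ 2) * qi =
    (x - u) * ((x - u) * qi + (y - v) * qr) -
    (y - v) * ((x - u) * qr - (y - v) * qi) by ring.
  by rewrite Er Ei !mulr0 subrr.
case: (difference_quotient_nonvanishing k2 z1 w1).
  by move: qr0; rewrite /qr; lra.
by move: qi0; rewrite /qi; lra.
Qed.

(** * Necessary conditions for univalence *)

Lemma univalent_conj_pair a b x y : univalent (cubic a b) ->
  x ^+ 2 + y ^+ 2 < 1 -> y != 0 ->
  1 + 2 * a * x + b * (3 * x ^+ 2 - y ^+ 2) != 0.
Proof.
move=> /univalent_cubicP inj z1 y0; apply/eqP => q0.
have im0 : cubic_im a b x y = 0.
  transitivity (y * (1 + 2 * a * x + b * (3 * x ^+ 2 - y ^+ 2))).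
    by rewrite /cubic_im; ring.
  by rewrite q0 mulr0.
have [||||_ yN] := inj x y x (- y) => //; first by rewrite sqrrN.
- by rewrite /cubic_re sqrrN.
- by rewrite im0 -oppr0 -im0 /cubic_im; ring.
by move/eqP: y0; apply; lra.
Qed.

(* On the ray through the point [x + iy] of the circle, the difference quotient
   at conjugate pairs starts at 1, so it has a zero inside the disc if it is
   negative on the circle. *)
Lemma univalent_typically_real a b x : univalent (cubic a b) -> -1 < x < 1 ->
  0 <= 1 - b + 2 * a * x + 4 * b * x ^+ 2.
Proof.
move=> uni x1; rewrite leNgt; apply/negP => q0.
have x2 : x ^+ 2 < 1.
  by rewrite -real_normK ?num_real// expr_lt1// ltr_norml.
have y2 : Num.sqrt (1 - x ^+ 2) ^+ 2 = 1 - x ^+ 2.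
  by rewrite sqr_sqrtr// subr_ge0 ltW.
have abx : b * (4 * x ^+ 2 - 1) + 2 * a * x + 1 < 0 by lra.
have [t /andP[t0 t1] tq] := quadratic_root abx.
pose y := t * Num.sqrt (1 - x ^+ 2).
apply: (negP (@univalent_conj_pair a b (t * x) y uni _ _)).
- by rewrite !exprMn y2 -mulrDr addrC subrK mulr1 expr_lt1 ?ltW.
- by rewrite mulf_neq0 ?gt_eqF// sqrtr_gt0 subr_gt0.
- by apply/eqP; rewrite -tq !exprMn y2; ring.
Qed.

Lemma univalent_at1 a b : univalent (cubic a b) -> 0 <= 1 + 2 * a + 3 * b.
Proof.
move=> uni.
rewrite (_ : _ + _ = (1 - b) + 2 * a + 4 * b); last ring.
by apply: quadratic_ge0_at1 => x; exact: univalent_typically_real.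
Qed.

Lemma univalent_atN1 a b : univalent (cubic a b) -> 0 <= 1 - 2 * a + 3 * b.
Proof.
move=> uni.
rewrite (_ : _ + _ = (1 - b) + - (2 * a) + 4 * b); last ring.
apply: quadratic_ge0_at1 => x x1.
have := @univalent_typically_real a b (- x) uni.
by rewrite sqrrN mulrN mulNr; apply; rewrite ltrN2 ltrNl andbC.
Qed.

Lemma univalent_vertex a b : univalent (cubic a b) -> 1 / 5 <= b ->
  a ^+ 2 <= 4 * b * (1 - b).
Proof.
move=> uni b5.
have b0 : 0 < 4 * b by lra.
have [a4|] := ltP (`|a|) (4 * b).
  (* This point is the vertex of the quadratic. *)
  have := @univalent_typically_real a b (- a / (4 * b)) uni.
  rewrite -ltr_norml normrM normrN normfV (gtr0_norm b0).
  rewrite ltr_pdivrMr ?mul1r ?a4// => /(_ isT).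
  rewrite -(@pmulr_rge0 _ (4 * b))//.
  rewrite (_ : 4 * b * (1 - b + _ + _) = 4 * b * (1 - b) - a ^+ 2) ?subr_ge0//.
  by field; apply/eqP; lra.
(* Combined with [2|a| <= 1 + 3b], [|a| >= 4b] leaves only [b = 1/5]. *)
have := univalent_at1 uni; have := univalent_atN1 uni.
case: (ger0P a) => a0 h1 h2 h3.
  have -> : b = 1 / 5 by lra.
  have -> : a = 4 / 5 by lra.
  lra.
have -> : b = 1 / 5 by lra.
have -> : a = - (4 / 5) by lra.
lra.
Qed.

(** With midpoint [m = x + iy], [(p(m + d) - p(m - d)) / (2 d) = p'(m) + b d^2]. *)
Lemma univalent_shift_pair a b x y d : univalent (cubic a b) -> 0 < d ->
  (x + d) ^+ 2 + y ^+ 2 < 1 -> (x - d) ^+ 2 + y ^+ 2 < 1 ->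
  1 + 2 * a * x + 3 * b * (x ^+ 2 - y ^+ 2) + b * d ^+ 2 = 0 ->
  2 * a * y + 6 * b * x * y = 0 -> False.
Proof.
move=> /univalent_cubicP inj d0 z1 w1 qr qi.
have [||xx _] := inj _ _ _ _ z1 w1; last lra.
  apply/eqP; rewrite -subr_eq0; apply/eqP.
  transitivity
    (2 * d * (1 + 2 * a * x + 3 * b * (x ^+ 2 - y ^+ 2) + b * d ^+ 2)).
    by rewrite /cubic_re; ring.
  by rewrite qr mulr0.
apply/eqP; rewrite -subr_eq0; apply/eqP.
transitivity (2 * d * (2 * a * y + 6 * b * x * y)).
  by rewrite /cubic_im; ring.
by rewrite qi mulr0.
Qed.

(* If [3 b > 1], the vertex condition makes the zeros of the derivative non-real,
   of squared modulus [1 / 3b < 1]. Such a zero, moved a little to [x + iy],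
   is the midpoint of a pair on which injectivity fails. *)
Lemma univalent_lead_coef_le a b : univalent (cubic a b) -> 3 * b <= 1.
Proof.
move=> uni; rewrite leNgt; apply/negP => b3.
have b0 : b != 0 by apply/eqP; lra.
have a2 : a ^+ 2 <= 4 * b * (1 - b) by apply: univalent_vertex => //; lra.
(* The point [m = x + iy] solves [p'(m) = - b d^2], so [3 b |m|^2 = 1 + b d^2]. This [d] makes
   [3 b (1 - d)^2 = 1 + 3 b d^2], hence [|m| < 1 - d] and [m + d], [m - d] lie in the disc. *)
pose d : R := (3 * b - 1) / (6 * b).
pose x : R := - a / (3 * b).
pose y : R := Num.sqrt (3 * b * (1 + b * d ^+ 2) - a ^+ 2) / (3 * b).
have d0 : 0 < d by rewrite divr_gt0//; lra.
have dE : 6 * b * d = 3 * b - 1 by rewrite /d; field.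
have xE : 3 * b * x = - a by rewrite /x; field.
have y2 : 9 * b ^+ 2 * y ^+ 2 = 3 * b * (1 + b * d ^+ 2) - a ^+ 2.
  rewrite /y expr_div_n sqr_sqrtr; first by field.
  have : 0 <= b ^+ 2 * d ^+ 2 by rewrite mulr_ge0 ?sqr_ge0.
  nra.
have n2 : 3 * b * (x ^+ 2 + y ^+ 2) = 1 + b * d ^+ 2.
  apply: (@mulfI _ (3 * b)); first by apply/eqP; lra.
  have : (3 * b * x) ^+ 2 = a ^+ 2 by rewrite xE sqrrN.
  lra.
have d1 : d < 1 / 2 by rewrite /d ltr_pdivrMr; lra.
have nd : x ^+ 2 + y ^+ 2 < (1 - d) ^+ 2.
  rewrite -(@ltr_pM2l _ (3 * b)) ?n2; last lra.
  have : 0 < b * d ^+ 2 by rewrite mulr_gt0 ?exprn_gt0//; lra.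
  lra.
have xd : `|x| < 1 - d.
  have : x ^+ 2 < (1 - d) ^+ 2 by have := sqr_ge0 y; lra.
  by rewrite -[x ^+ 2]real_normK ?num_real// ltr_sqr ?nnegrE//; lra.
have {xd} /andP[xd1 xd2] : - (1 - d) < x < 1 - d by rewrite -ltr_norml.
have H1 : 0 < d * (1 - d - x) by rewrite mulr_gt0//; lra.
have H2 : 0 < d * (1 - d + x) by rewrite mulr_gt0//; lra.
apply: (@univalent_shift_pair a b x y d uni d0).
- lra.
- lra.
- have : x * (3 * b * x) = - (x * a) by rewrite xE mulrN.
  lra.
- have : y * (3 * b * x) = - (y * a) by rewrite xE mulrN.
  lra.
Qed.

(** * Minimum modulus and extremal polynomials *)

Lemma normc_cubic a b x y : x ^+ 2 + y ^+ 2 = 1 ->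
  ComplexField.Normc.normc (cubic a b).[x +i* y] ^+ 2 = cubic_sqmod a b x.
Proof.
pose n := x ^+ 2 + y ^+ 2 => n1.
rewrite horner_cubic /= sqr_sqrtr ?addr_ge0 ?sqr_ge0//.
(* Keeping [n = |z|^2] makes this a polynomial identity; [n = 1] is used afterwards. *)
transitivity (n * (1 + a ^+ 2 * n + b ^+ 2 * n ^+ 2 +
    2 * a * x * (1 + b * n) + 2 * b * (2 * x ^+ 2 - n))).
  by rewrite /cubic_re /cubic_im /n; ring.
by rewrite /n n1 /cubic_sqmod; ring.
Qed.

Lemma normc_ge0 (z : R[i]) : 0 <= ComplexField.Normc.normc z.
Proof. by case: z => x y; exact: sqrtr_ge0. Qed.

Lemma univalent_min_modulus a b (r := Num.sqrt 5 : R) :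
  univalent (cubic a b) ->
  (3 - r) / 2 <= min_modulus (cubic a b) /\
  (min_modulus (cubic a b) = (3 - r) / 2 ->
   cubic a b = p3 R \/ cubic a b = p3star R).
Proof.
move=> uni.
have /andP[r_lo r_hi] : 199 / 89 < r < 9 / 4 by exact: sqrt5_bounds.
have h1 := univalent_at1 uni; have h1' := univalent_atN1 uni.
have h2 := univalent_lead_coef_le uni; have h3 := univalent_vertex uni.
have [[x y] /unit_circleE n1 [-> _]] := min_modulus_attained (cubic a b).
have sq := normc_cubic a b n1.
have x1 : -1 <= x <= 1.
  rewrite -ler_norml -(@expr_le1 _ 2)// real_normK ?num_real//.
  by rewrite -n1 lerDl sqr_ge0.
have m0 := normc_ge0 (cubic a b).[x +i* y].
have e0 : 0 <= (3 - r) / 2 by lra.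
rewrite -ler_sqr ?nnegrE// sq.
have [a0|/ltW a0] := leP 0 a.
  have ha : 2 * a <= 1 + 3 * b by lra.
  have := cubic_sqmod_bound a0 ha h2 h3 x1; rewrite -/r => -[q1 q2].
  split=> // mE; left.
  by rewrite mE in sq; have [-> ->] := q2 (esym sq).
(* The case [a < 0] follows by passing to [- p(- z)]. *)
have na0 : 0 <= - a by rewrite oppr_ge0.
have nh1 : 2 * - a <= 1 + 3 * b by lra.
have nh3 : 1 / 5 <= b -> (- a) ^+ 2 <= 4 * b * (1 - b) by rewrite sqrrN.
have nx1 : -1 <= - x <= 1 by rewrite lerN2 lerNl andbC.
have := cubic_sqmod_bound na0 nh1 h2 nh3 nx1.
have -> : cubic_sqmod (- a) b (- x) = cubic_sqmod a b x.
  by rewrite /cubic_sqmod; ring.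
rewrite -/r => -[q1 q2]; split=> // mE; right.
rewrite mE in sq; have [aE ->] := q2 (esym sq).
by rewrite p3starE -(opprK a) aE.
Qed.

(* [s = 1] is [p3] and [s = -1] is [p3star]. *)
Lemma univalent_golden s (r := Num.sqrt 5 : R) : s ^+ 2 = 1 ->
  univalent (cubic (s * (2 / r)) (1 / 2 * (1 - 1 / r))).
Proof.
move=> s1.
have r2 : r ^+ 2 = 5 := sqrt5_sqr R.
have /andP[r_lo r_hi] : 199 / 89 < r < 9 / 4 by exact: sqrt5_bounds.
have rV : r^-1 = r / 5 := sqrt5V R.
(* The square of the golden ratio, about 2.618, just exceeds 13/5. *)
have k2 : (s * ((1 + r) / 2)) ^+ 2 = (3 + r) / 2.
  by rewrite exprMn s1 mul1r; lra.
apply: (@cubic_univalent (s * ((1 + r) / 2))); rewrite ?k2 ?rV; [lra|lra|].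
transitivity (s * (2 * (r / 5)) + s * (5 - r ^+ 2) / 10); last by field.
by rewrite r2 subrr mulr0 mul0r addr0.
Qed.

Lemma min_modulus_le (p : {poly R[i]}) x y : x ^+ 2 + y ^+ 2 = 1 ->
  min_modulus p <= ComplexField.Normc.normc p.[x +i* y].
Proof.
move=> n1; have [z _ [-> zmin]] := min_modulus_attained p.
exact/zmin/unit_circleE.
Qed.

Lemma min_modulus_golden s (r := Num.sqrt 5 : R) : s ^+ 2 = 1 ->
  min_modulus (cubic (s * (2 / r)) (1 / 2 * (1 - 1 / r))) = (3 - r) / 2.
Proof.
move=> s1; apply/eqP; rewrite eq_le.
rewrite (univalent_min_modulus (univalent_golden s1)).1 andbT.
(* The minimum is attained at [z = - s]. *)
have n1 : (- s) ^+ 2 + 0 ^+ 2 = 1 by rewrite sqrrN s1 expr0n addr0.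
apply: le_trans (min_modulus_le _ n1) _.
have r2 : r ^+ 2 = 5 := sqrt5_sqr R.
have /andP[r_lo r_hi] : 199 / 89 < r < 9 / 4 by exact: sqrt5_bounds.
have rV : r^-1 = r / 5 := sqrt5V R.
rewrite -ler_sqr ?nnegrE ?normc_ge0//; last lra.
rewrite (normc_cubic _ _ n1) -/r rV /cubic_sqmod.
rewrite (_ : 2 * (s * (2 * (r / 5))) * (1 + 1 / 2 * (1 - 1 * (r / 5))) * - s =
  - s ^+ 2 * (4 * r / 5) * (1 + (1 - r / 5) / 2)); last by field.
by rewrite exprMn sqrrN s1; lra.
Qed.

Lemma extremal_U3R (F : {poly R[i]}) : U3R R F ->
  min_modulus F = (3 - Num.sqrt 5) / 2 -> extremal (U3R R) F.
Proof.
move=> UF mF; split=> //; apply/eqP; rewrite eq_le; apply/andP; split.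
  apply: ge_inf; last by exists F.
  exists ((3 - Num.sqrt 5) / 2) => _ [_ [[a [b ->]] uni] <-].
  by have [] := univalent_min_modulus uni.
apply: lb_le_inf; first by exists (min_modulus F), F.
move=> _ [_ [[a [b ->]] uni] <-]; rewrite mF.
by have [] := univalent_min_modulus uni.
Qed.

Lemma extremal_golden s : s ^+ 2 = 1 ->
  extremal (U3R R)
    (cubic (s * (2 / Num.sqrt 5)) (1 / 2 * (1 - 1 / Num.sqrt 5))).
Proof.
move=> s1; apply: extremal_U3R; last exact: min_modulus_golden.
split; last exact: univalent_golden.
by exists (s * (2 / Num.sqrt 5)), (1 / 2 * (1 - 1 / Num.sqrt 5)).
Qed.

End Univalence.

Theorem theorem5p1 (R : realType) :
  [/\ extremal (U3R R) (p3 R),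
      extremal (U3R R) (p3star R) &
      forall F : {poly R[i]},
        extremal (U3R R) F -> F = p3 R \/ F = p3star R].
Proof.
have e3 : extremal (U3R R) (p3 R).
  by have := extremal_golden (expr1n R 2); rewrite mul1r.
split=> //.
  have := extremal_golden (sqrr_sign R 1).
  by rewrite expr1 mulN1r -p3starE.
have m3 : min_modulus (p3 R) = (3 - Num.sqrt 5) / 2.
  by have := min_modulus_golden (expr1n R 2); rewrite mul1r.
move=> _ [[[a [b ->]] uni]]; rewrite e3.2 m3 => /esym.
exact: (univalent_min_modulus uni).2.
Qed.
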